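(* Let $\alpha_1,\alpha_2\in(0,1]$ and let $f\in\mathbb{H}^{\alpha_1}$ and $g\in\mathbb{H}^{\alpha_2}$ be functions $\mathbb{R}\to\mathbb{R}$. Then for every real $x$, every $\epsilon>0$ and every $\beta\in(0,1]$, $$\upsilon_{\beta}^{\epsilon+}[f g](x)=\upsilon_{\beta}^{\epsilon+}[f](x)\,g(x)+\upsilon_{\beta}^{\epsilon+}[g](x)\,f(x)+[f,g]_{\beta}^{\epsilon+}(x),$$ $$\upsilon_{\beta}^{\epsilon-}[f g](x)=\upsilon_{\beta}^{\epsilon-}[f](x)\,g(x)+\upsilon_{\beta}^{\epsilon-}[g](x)\,f(x)-[f,g]_{\beta}^{\epsilon-}(x).$$
   Context: For $\epsilon>0$ and $0<\beta\le 1$ the fractional variation operators are $\upsilon_{\beta}^{\epsilon+}[f](x)=\frac{f(x+\epsilon)-f(x)}{\epsilon^{\beta}}$ and $\upsilon_{\beta}^{\epsilon-}[f](x)=\frac{f(x)-f(x-\epsilon)}{\epsilon^{\beta}}$. They are defined by the same formulas for every real order, in particular for order $\beta/2$. The fractional co-variation operators are $[f,g]_{\beta}^{\epsilon\pm}(x)=\upsilon_{\beta/2}^{\epsilon\pm}[f](x)\,\upsilon_{\beta/2}^{\epsilon\pm}[g](x)$. For $\alpha\in(0,1]$, a continuous function $f$ is of Hölder class $\mathbb{H}^{\alpha}$ if there are constants $C,\delta>0$ such that $|f(x)-f(y)|\le C|x-y|^{\alpha}$ for $x,y$ in the domain of $f$ with $|x-y|\le\delta$. *)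

(* Defs.v *)
From HB Require Import structures.
From mathcomp Require Import all_boot all_order all_algebra.
From mathcomp Require Import all_classical all_reals all_analysis.

Set Implicit Arguments.
Unset Strict Implicit.
Unset Printing Implicit Defensive.

Import Order.TTheory GRing.Theory Num.Theory.
Import numFieldNormedType.Exports.

Local Open Scope ring_scope.

(* The Hölder constants are uniform over the whole line, but the estimate is
   only required at scales at most delta. At x = y the right-hand side is 0
   when 0 < alpha, by the convention 0 `^ alpha = 0. *)
Definition holder_class (R : realType) (alpha : R) (f : R -> R) : Prop :=
  continuous f /\
  exists C delta : R,
    [/\ 0 < C, 0 < delta &
        forall x y : R, `|x - y| <= delta ->
          `|f x - f y| <= C * `|x - y| `^ alpha].

(* The order beta is an arbitrary real number; eps is meant to be positive. *)
Definition frac_var_fwd (R : realType) (beta eps : R) (f : R -> R) (x : R) : R :=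
  (f (x + eps) - f x) / eps `^ beta.

Definition frac_var_bwd (R : realType) (beta eps : R) (f : R -> R) (x : R) : R :=
  (f x - f (x - eps)) / eps `^ beta.

Definition frac_covar_fwd (R : realType) (beta eps : R) (f g : R -> R) (x : R)
    : R :=
  frac_var_fwd (beta / 2) eps f x * frac_var_fwd (beta / 2) eps g x.

Definition frac_covar_bwd (R : realType) (beta eps : R) (f g : R -> R) (x : R)
    : R :=
  frac_var_bwd (beta / 2) eps f x * frac_var_bwd (beta / 2) eps g x.

(* Main.v *)
(* Both identities are the discrete product rule
   [d(fg) = df * g + dg * f +/- df * dg]; dividing the last term by
   [eps `^ beta = eps `^ (beta / 2) * eps `^ (beta / 2)] gives the co-variation. *)
Require Import Defs.
From HB Require Import structures.
From mathcomp Require Import all_boot all_order all_algebra.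
From mathcomp Require Import all_classical all_reals all_analysis.
From mathcomp Require Import ring.

Set Implicit Arguments.
Unset Strict Implicit.
Unset Printing Implicit Defensive.

Import Order.TTheory GRing.Theory Num.Theory.
Import numFieldNormedType.Exports.

Local Open Scope ring_scope.

(** Exponents add along [b = b / 2 + b / 2]; [a != 0] settles the side condition of [powRD] for
    exponents with sum 0. *)
Lemma powR_halfM (R : realType) (a b : R) :
  a != 0 -> a `^ b = a `^ (b / 2) * a `^ (b / 2).
Proof. by move=> a0; rewrite -powRD -?splitr// a0 implybT. Qed.

Theorem theorem5 (R : realType) (alpha1 alpha2 : R) (f g : R -> R)
  (halpha1 : 0 < alpha1 <= 1) (halpha2 : 0 < alpha2 <= 1)
  (hf : holder_class alpha1 f) (hg : holder_class alpha2 g)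
  (x eps beta : R) (heps : 0 < eps) (hbeta : 0 < beta <= 1) :
  frac_var_fwd beta eps (f \* g) x =
    frac_var_fwd beta eps f x * g x + frac_var_fwd beta eps g x * f x
    + frac_covar_fwd beta eps f g x
  /\
  frac_var_bwd beta eps (f \* g) x =
    frac_var_bwd beta eps f x * g x + frac_var_bwd beta eps g x * f x
    - frac_covar_bwd beta eps f g x.
Proof.
have u0 : eps `^ (beta / 2) != 0 by rewrite gt_eqF// powR_gt0.
rewrite /frac_covar_fwd /frac_covar_bwd /frac_var_fwd /frac_var_bwd /=.
(* Now [eps] [^ (beta / 2)] is the only denominator, nonzero by [u0], so both goals are rational
   identities. *)
rewrite (powR_halfM beta (lt0r_neq0 heps)).
(* The sign of the co-variation flips in the backward case because [f x] and [g x] are then values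
   at the right end of the increment. *)
by split; field.
Qed.
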